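(* For every integer $\ell\ge 1$ and every complex number $s$ with $\Re(s)>2$, $$\sum_{n=1}^{\infty}\frac{\phi_\ell(n)}{n^{s}}=\frac{\zeta(s-1)}{\zeta\bigl(\ell(s-1)+1\bigr)}.$$
   Context: For an integer $\ell\ge 1$ and a positive integer $n$, the Euler $\ell$-totient is $$\phi_\ell(n):=n\prod_{\substack{p\ \text{prime}\\ p^\ell\mid n}}\left(1-\frac1p\right)$$ (an empty product equals $1$). $\zeta$ is the Riemann zeta function. *)

(* Defs.v *)
From mathcomp Require Import all_boot all_order all_algebra.
From mathcomp Require Import all_classical all_reals all_analysis.
From mathcomp Require Import complex.

Set Implicit Arguments.
Unset Strict Implicit.
Unset Printing Implicit Defensive.

Import Order.TTheory GRing.Theory Num.Theory.
Import numFieldNormedType.Exports.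

Local Open Scope ring_scope.
Local Open Scope classical_set_scope.
Local Open Scope complex_scope.

(* For n > 0 and l > 0, every prime p with p ^ l %| n satisfies p <= n, so
   the range p < n.+1 omits no factor. *)
Definition totient_l (F : numFieldType) (l n : nat) : F :=
  n%:R * \prod_(0 <= p < n.+1 | prime p && (p ^ l %| n)%N) (1 - p%:R^-1).

Definition cexp (R : realType) (z : R[i]) : R[i] :=
  (expR (complex.Re z))%:C * (cos (complex.Im z) +i* sin (complex.Im z)).

(* n ^ s = exp (s log n), with the real logarithm of n; relevant for n > 0 *)
Definition ncpow (R : realType) (n : nat) (s : R[i]) : R[i] :=
  cexp (s * (ln (n%:R : R))%:C).

(* The term of index k of a Dirichlet series (starting at n = 1) is the one
   for n = k.+1.  The ^o selects the topology given by the complex modulus. *)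
Definition dirichlet_term (R : realType) (a : nat -> R[i]) (s : R[i])
  : nat -> R[i]^o := fun k => a k.+1 / ncpow k.+1 s.

(* The Riemann zeta function on its half-plane of convergence Re s > 1; the
   value is irrelevant elsewhere (no analytic continuation is encoded). *)
Definition zeta (R : realType) (s : R[i]) : R[i]^o :=
  limn (series (dirichlet_term (fun _ => 1) s)).

(* Main.v *)
Require Import Defs.
From mathcomp Require Import all_boot all_order all_algebra.
From mathcomp Require Import all_classical all_reals all_analysis.
From mathcomp Require Import complex ring lra.
From mathcomp Require cyclic.

Import Order.TTheory GRing.Theory Num.Theory.
Import numFieldNormedType.Exports.

Local Open Scope ring_scope.
Local Open Scope classical_set_scope.

(** Put w = s - 1, u = l w + 1, and let D be the sum of phi_l(n) n^-s.  The
proof establishes zeta(u) D = zeta(w) and divides by zeta(u).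

Multiplying the series termwise, the product of the terms d^-u and
phi_l(m) m^-s is (d^l m)^-w times (1/d) (phi_l(m)/m).  Grouping the pairs
(d, m) by the value n = d^l m, the product formula reduces to the arithmetic
identity [sum_totient_l_ratio]: for every n > 0,

  sum over d^l m = n of (1/d) (phi_l(m)/m) = 1.

To see it, let r be the largest integer with r^l | n.  Then d^l | n exactly
when d | r [exists_dvd_root], so, for m = n/d^l, a prime p satisfies p^l | m
exactly when p | r/d.  By Euler's product, phi_l(m)/m = phi(r/d)/(r/d), where
phi is the ordinary totient [totient_l_ratio], and the sum collapses to
(1/r) times the sum of phi(r/d) over d | r, which is 1 by Gauss.

The grouping is legitimate because both series converge absolutely: since
|phi_l(m)| <= m, they are dominated by the Riemann series of exponents Re u and
Re w, both larger than 1.  A sum over index sets exhausting the quadrant then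
converges to the product of the two sums [cvg_exhausting_sum]; here the index
sets are the pairs with d^l m <= N, whose sums are exactly the partial sums of
zeta(w).

Finally zeta(u) is nonzero because Re u >= 2 forces |zeta(u) - 1| <= 3/4
[zeta_neq0]. *)

(** * The arithmetic identity *)

Lemma expn_lcmn (a b l : nat) : ((lcmn a b) ^ l = lcmn (a ^ l) (b ^ l))%N.
Proof.
have [->|a0] := posnP a; first case: l => [|l].
- by [].
- by rewrite lcm0n !exp0n // lcm0n.
have g0 : (0 < gcdn a b)%N by rewrite gcdn_gt0 a0.
have eqa := divnK (dvdn_gcdl a b); have eqb := divnK (dvdn_gcdr a b).
set g := gcdn a b in g0 eqa eqb; set x := (a %/ g)%N in eqa.
set y := (b %/ g)%N in eqb.
have cxy : coprime x y.
  by rewrite /coprime -(eqn_pmul2r g0) muln_gcdl eqa eqb mul1n.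
have lcm_cop u v h : coprime u v -> (lcmn (u * h) (v * h) = u * v * h)%N.
  move=> cuv; rewrite -muln_lcml; congr (_ * _)%N.
  by have := muln_lcm_gcd u v; rewrite (eqP cuv) muln1.
by rewrite -eqa -eqb !expnMn !lcm_cop ?coprimeXl ?coprimeXr // !expnMn.
Qed.

(** The root r is the largest integer whose l-th power divides n.  If d is
another one, then lcm(d, r)^l = lcm(d^l, r^l) also divides n, so maximality
gives lcm(d, r) = r, that is, d | r. *)
Lemma exists_dvd_root (l n : nat) : (0 < l)%N -> (0 < n)%N ->
  exists2 r : nat, (0 < r)%N & forall d, (d ^ l %| n)%N = (d %| r)%N.
Proof.
move=> l0 n0.
have P1 : exists d, (d ^ l %| n)%N by exists 1%N; rewrite exp1n dvd1n.
have bP d : (d ^ l %| n)%N -> (d <= n)%N.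
  move=> dn; have [->//|d0] := posnP d.
  apply: leq_trans (dvdn_leq n0 dn).
  by rewrite -[X in (X <= _)%N]expn1 leq_pexp2l.
case: (ex_maxnP P1 bP) => r rn rmax.
have r0 : (0 < r)%N by apply: rmax; rewrite exp1n dvd1n.
exists r => // d; apply/idP/idP => [dn|/(dvdn_exp2r l)/dvdn_trans-> //].
have : (lcmn d r ^ l %| n)%N by rewrite expn_lcmn dvdn_lcm dn.
move/rmax => le_r; suff <- : lcmn d r = r by rewrite dvdn_lcml.
have d0 : (0 < d)%N.
  by case: d dn {le_r} => //; rewrite exp0n // dvd0n eqn0Ngt n0.
by apply/eqP; rewrite eqn_leq le_r dvdn_leq ?dvdn_lcmr // lcmn_gt0 d0.
Qed.

Lemma prod_nat_bounded_support (F : comNzRingType) (Q : pred nat)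
    (f : nat -> F) (a b : nat) :
  (forall p, Q p -> (p <= a)%N) -> (forall p, Q p -> (p <= b)%N) ->
  \prod_(0 <= p < a.+1 | Q p) f p = \prod_(0 <= p < b.+1 | Q p) f p.
Proof.
wlog leab : a b / (a <= b)%N => [H Qa Qb|Qa _].
  by case/orP: (leq_total a b) => ?; [|symmetry]; apply: H.
rewrite (big_nat_widen 0 a.+1 b.+1) //; apply: eq_bigl => p.
by rewrite ltnS; case: (boolP (Q p)) => // /Qa ->.
Qed.

Lemma totient_euler_product (F : numFieldType) (n : nat) : (0 < n)%N ->
  (totient n)%:R = n%:R * \prod_(0 <= p < n.+1 | prime p && (p %| n)%N)
                             (1 - p%:R^-1) :> F.
Proof.
move=> n0.
have -> : \prod_(0 <= p < n.+1 | prime p && (p %| n)%N) (1 - p%:R^-1)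
          = \prod_(p <- primes n) (1 - p%:R^-1) :> F.
  rewrite -big_filter; apply: perm_big; apply: uniq_perm.
  - by rewrite filter_uniq // iota_uniq.
  - exact: primes_uniq.
  move=> p; rewrite mem_filter mem_index_iota mem_primes n0 /= ltnS.
  by case: (boolP (p %| n)%N) => [/(dvdn_leq n0) -> |]; rewrite ?andbT ?andbF.
rewrite totientE // [X in _ = X%:R * _](prod_prime_decomp n0) prime_decompE big_map /=.
rewrite !natr_prod -big_split /=; apply: eq_big_seq => p.
rewrite -logn_gt0 /= => lp; have : p \in primes n by rewrite -logn_gt0.
rewrite mem_primes => /and3P[/prime_gt0 p0 _ _].
have pF : p%:R != 0 :> F by rewrite pnatr_eq0 -lt0n.
rewrite -[in RHS](prednK lp) expnSr !natrM mulrBr mulr1 mulfK //.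
by rewrite mulrC -[in p.-1]subn1 natrB // mulrBr mulr1.
Qed.

(** For n = d^l m, both sides are the product of 1 - 1/p over the same primes:
p^l | m iff (p d)^l | n iff p d | r iff p | r/d. *)
Lemma totient_l_ratio (F : numFieldType) (l n r d m : nat) :
  (0 < r)%N -> (forall e, (e ^ l %| n)%N = (e %| r)%N) ->
  (0 < d)%N -> (0 < m)%N -> (0 < l)%N -> (d ^ l * m = n)%N ->
  totient_l F l m / m%:R = (totient (r %/ d))%:R / (r %/ d)%:R.
Proof.
move=> r0 rP d0 m0 l0 dmn.
have dr : (d %| r)%N by rewrite -rP -dmn dvdn_mulr.
have q0 : (0 < r %/ d)%N by rewrite divn_gt0 // dvdn_leq.
rewrite totient_euler_product // /totient_l.
rewrite [LHS]mulrAC [RHS]mulrAC !divff ?pnatr_eq0 -?lt0n // !mul1r.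
have Qe p : (p ^ l %| m)%N = (p %| r %/ d)%N.
  rewrite dvdn_divRL // -rP expnMn -dmn mulnC.
  by rewrite dvdn_pmul2l // expn_gt0 d0.
under eq_bigl => p do rewrite Qe.
apply: prod_nat_bounded_support => p /andP[pp pq]; last exact: dvdn_leq.
move: pq; rewrite -Qe => /(dvdn_leq m0); apply: leq_trans.
by rewrite -[X in (X <= _)%N]expn1 leq_pexp2l // prime_gt0.
Qed.

(** Gauss's identity, reindexed by the involution d |-> r/d on the divisors
of r. *)
Lemma sum_totient_codivisor (r : nat) : (0 < r)%N ->
  (\sum_(d < r.+1 | d %| r) totient (r %/ d) = r)%N.
Proof.
move=> r0; rewrite -[RHS]cyclic.sum_totient_dvd.
have hE (d : 'I_r.+1) : (inord (r %/ d) : 'I_r.+1) = (r %/ d)%N :> nat.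
  by rewrite inordK // ltnS leq_div.
rewrite [RHS](reindex_onto (fun d : 'I_r.+1 => inord (r %/ d) : 'I_r.+1)
                     (fun d : 'I_r.+1 => inord (r %/ d) : 'I_r.+1)) /=; last first.
  move=> d dr; apply: val_inj; rewrite /= !hE divnA //.
  by rewrite mulKn.
apply: eq_big => d; last by rewrite hE.
rewrite -(inj_eq (@ord_inj _)) (hE (inord (r %/ d))) hE.
case: (boolP (d %| r)%N) => dr; last first.
  apply/esym/negP => /andP[q1 /eqP q2]; case/negP: dr.
  by rewrite -q2; apply: dvdn_div.
by rewrite dvdn_div //= divnA // mulKn ?eqxx.
Qed.

(** This says that the Dirichlet series with terms d^-1 d^(-l w) and
(phi_l(m)/m) m^-w multiply to zeta(w).  The indices are shifted by one, and
the bound B only has to exceed n since d^l m = n + 1 bounds both d and m. *)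
Lemma sum_totient_l_ratio (F : numFieldType) (l n B : nat) :
  (0 < l)%N -> (n < B)%N ->
  \sum_(d < B) \sum_(m < B | (d.+1 ^ l * m.+1 == n.+1)%N)
     d.+1%:R^-1 * (totient_l F l m.+1 / m.+1%:R) = 1.
Proof.
move=> l0 nB.
have [r r0 rP] := @exists_dvd_root l n.+1 l0 isT.
have rn : (r <= n.+1)%N.
  apply: leq_trans (dvdn_leq (ltn0Sn n) (_ : r ^ l %| n.+1)%N); last by rewrite rP.
  by rewrite -[X in (X <= _)%N]expn1 leq_pexp2l.
have rF : r%:R != 0 :> F by rewrite pnatr_eq0 -lt0n.
(* For a given d at most one m qualifies, namely (n + 1) / d^l. *)
have inner (d : 'I_B) :
    \sum_(m < B | (d.+1 ^ l * m.+1 == n.+1)%N)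
       d.+1%:R^-1 * (totient_l F l m.+1 / m.+1%:R) =
    if (d.+1 %| r)%N then (totient (r %/ d.+1))%:R / r%:R else 0.
  rewrite -rP; case: ifPn => [dn|ndn]; last first.
    rewrite big_pred0 // => m; apply/eqP => dmn; case/negP: ndn.
    by rewrite -dmn dvdn_mulr.
  have dl0 : (0 < d.+1 ^ l)%N by rewrite expn_gt0.
  have mB : ((n.+1 %/ d.+1 ^ l).-1 < B)%N.
    apply: leq_ltn_trans nB; rewrite -ltnS prednK ?ltnS ?leq_div //.
    by rewrite divn_gt0 // dvdn_leq.
  have mS : (n.+1 %/ d.+1 ^ l).-1.+1 = (n.+1 %/ d.+1 ^ l)%N.
    by rewrite prednK // divn_gt0 // dvdn_leq.
  rewrite (big_pred1 (Ordinal mB)) => [/=|m]; last first.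
    rewrite inE -(inj_eq (@ord_inj _)) /= -[RHS]eqSS mS; apply/eqP/eqP => [<-|->].
      by rewrite mulKn.
    by rewrite mulnC divnK.
  rewrite (@totient_l_ratio _ l n.+1 r d.+1) //; last by rewrite mS mulnC divnK.
  have dr : (d.+1 %| r)%N by rewrite -rP.
  have -> : r%:R = (r %/ d.+1)%:R * d.+1%:R :> F by rewrite -natrM divnK.
  by rewrite invfM mulrC -mulrA.
under eq_bigr => d _ do rewrite inner.
rewrite -big_mkcond /= -mulr_suml -natr_sum.
suff -> : (\sum_(i < B | i.+1 %| r) totient (r %/ i.+1) = r)%N by rewrite divff.
rewrite -[RHS](sum_totient_codivisor _ r0).
(* The divisors here are the successors i + 1; the term d = 0 of Gauss's sum
   is dropped because 0 does not divide r. *)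
rewrite [RHS]big_mkcond big_ord_recl /= dvd0n eqn0Ngt r0 /= add0n -big_mkcond /=.
rewrite -(big_mkord (fun i => i.+1 %| r)%N (fun i => totient (r %/ i.+1))).
rewrite -(big_mkord (fun i => i.+1 %| r)%N (fun i => totient (r %/ i.+1))).
rewrite (big_nat_widen 0 r B) ?(leq_trans rn) //; apply: eq_bigl => i.
by case: (boolP (i.+1 %| r)%N) => // /(dvdn_leq r0) ->.
Qed.

Lemma totient_l_bound (F : numFieldType) (l n : nat) :
  0 <= totient_l F l n <= n%:R.
Proof.
have f01 p : prime p -> 0 <= (1 - p%:R^-1 : F) <= 1.
  move=> /prime_gt1 p1; rewrite subr_ge0 gerBl invr_ge0 ler0n andbT.
  by rewrite invf_le1 ?ler1n ?ltr0n ltnW.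
rewrite /totient_l; set q := \prod_(_ <= _ < _ | _) _.
have /andP[q0 q1] : 0 <= q <= 1.
  rewrite prodr_ge0 /=; last by move=> p /andP[/f01/andP[]].
  by apply: prodr_ile1 => p /andP[/f01].
by rewrite mulr_ge0 //= ler_piMr.
Qed.

(** * Absolutely convergent complex series *)

Local Open Scope complex_scope.

Lemma norm_real_complex (R : rcfType) (x : R) : `|x%:C| = `|x|%:C.
Proof. by rewrite normc_def /= expr0n addr0 sqrtr_sqr. Qed.

Lemma norm_complex_le (R : rcfType) (a b : R) : `|a +i* b| <= (`|a| + `|b|)%:C.
Proof.
rewrite [a +i* b]complexE.
apply: le_trans (ler_normD _ _) _; rewrite normrM !norm_real_complex rmorphD /=.
by rewrite normc_def /= expr0n expr1n add0r sqrtr1 mul1r.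
Qed.

Lemma normRe_le (R : rcfType) (z : R[i]) (r : R) : `|z| <= r%:C -> `|complex.Re z| <= r.
Proof. by move=> h; rewrite -lecR; apply: le_trans h; apply: normc_ge_Re. Qed.

Lemma normIm_le (R : rcfType) (z : R[i]) (r : R) : `|z| <= r%:C -> `|complex.Im z| <= r.
Proof.
case: z => a b; rewrite normc_def lecR /=; apply: le_trans.
by rewrite -sqrtr_sqr ler_wsqrtr // lerDr sqr_ge0.
Qed.

(** A positive radius in the ordered field of complex numbers is a positive
real, so a real null sequence is enough to bound the distance to the limit. *)
Lemma cvg_complex_bound (R : realType) (f : nat -> R[i]^o) (l : R[i]^o) (e : nat -> R) :
  (forall n, `|l - f n| <= (e n)%:C) -> e @ \oo --> 0 -> f @ \oo --> l.
Proof.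
move=> fe /cvgrPdist_lt e0; apply/cvgrPdist_lt => eps eps0.
have [x xE] : exists x : R, eps = x%:C.
  by exists (complex.Re eps); rewrite RRe_real // gtr0_real.
rewrite {}xE ltcR in eps0 *.
have := e0 _ eps0; apply: filterS => n; rewrite sub0r normrN => en.
by apply: le_lt_trans (fe n) _; rewrite ltcR (le_lt_trans (ler_norm _)).
Qed.

(** Absolute convergence is transferred from the reals, through the real and
imaginary parts, each of which is dominated by the modulus. *)
Lemma cvg_series_complex (R : realType) (z : nat -> R[i]^o) (r : nat -> R) :
  (forall k, `|z k| <= (r k)%:C) -> cvgn (series r) -> cvgn (series z).
Proof.
move=> zr rcv.
have dominated (x : nat -> R) : (forall k, `|x k| <= r k) -> cvgn (series x).
  move=> xr; apply: (@normed_cvg _ R^o); apply: (series_le_cvg _ _ _ rcv) => n.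
  - exact: normr_ge0.
  - exact: le_trans (normr_ge0 _) (xr n).
  - exact: xr.
set x := fun k => complex.Re (z k); set y := fun k => complex.Im (z k).
have xcv : cvgn (series x) by apply: dominated => k; apply: normRe_le.
have ycv : cvgn (series y) by apply: dominated => k; apply: normIm_le.
have zE n : series z n = series x n +i* series y n.
  elim: n => [|n IH]; first by rewrite /series /= !big_nil.
  by rewrite !seriesSr IH /x /y; case: (z n) => a b /=; simpc.
apply/cvg_ex; exists (limn (series x) +i* limn (series y) : R[i]^o).
apply: (@cvg_complex_bound _ _ _
  (fun n => `|limn (series x) - series x n| + `|limn (series y) - series y n|)).
  move=> n; rewrite zE.
  exact: (norm_complex_le _ (limn (series x) - series x n) (limn (series y) - series y n)).
have d0 (v : nat -> R) : cvgn v -> (fun n => `|limn v - v n|) @ \oo --> 0.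
  move=> vcv; rewrite -(normr0 R) -(subrr (limn v)).
  by apply: cvg_norm; apply: cvgB => //; apply: cvg_cst.
by rewrite -(addr0 0); apply: cvgD; apply: d0.
Qed.

(** With t = a - 1, the term N^-a is at most ((N - 1)^-t - N^-t) / t, so the
partial sums telescope below 1 + 1/t.  The bound on the terms comes from
ln(1 - 1/N) <= -1/N, which gives (N - 1)^-t >= N^-t exp(t/N), and from
exp x >= 1 + x. *)
Lemma cvg_riemannR (R : realType) (a : R) : 1 < a -> cvgn (series (riemannR a)).
Proof.
move=> a1; set t := a - 1; have t0 : 0 < t by rewrite subr_gt0.
have r0 k : 0 <= riemannR a k by rewrite ltW // riemannR_gt0 // ltW // (lt_trans _ a1).
apply: nondecreasing_is_cvgn.
  by apply: nondecreasing_series => n _ _; apply: r0.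
exists (1 + t^-1) => _ [n _ <-].
have powRV (x s : R) : 0 < x -> (x `^ s)^-1 = expR (- (s * ln x)).
  by move=> x0; rewrite /powR gt_eqF // expRN.
have step k : riemannR a k.+1 <= t^-1 * ((k.+1%:R `^ t)^-1 - (k.+2%:R `^ t)^-1).
  rewrite ler_pdivlMl // /riemannR !powRV //.
  have N0 : 0 < k.+2%:R :> R by [].
  have ln_le : ln (k.+1%:R : R) <= ln k.+2%:R - k.+2%:R^-1.
    have -> : k.+1%:R = k.+2%:R * (1 + - k.+2%:R^-1) :> R.
      by rewrite mulrDr mulr1 mulrN divff // -(natrB _ (_ : 1 <= k.+2)%N) // subn1.
    have V1 : k.+2%:R^-1 < 1 :> R by rewrite invf_lt1 // ltr1n.
    by rewrite lnM ?posrE ?subr_gt0 // lerD2l le_ln1Dx // ltrN2.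
  have expa : expR (- (a * ln k.+2%:R)) = expR (- (t * ln k.+2%:R)) * k.+2%:R^-1 :> R.
    rewrite -[X in _ * X^-1](lnK (_ : k.+2%:R \is Num.pos)) ?posrE // -expRN -expRD.
    by congr expR; rewrite /t; ring.
  rewrite lerBrDr.
  apply: (@le_trans _ _ (expR (- (t * ln k.+2%:R) + t * k.+2%:R^-1))); last first.
    have := ler_wpM2l (ltW t0) ln_le; rewrite mulrBr ler_expR.
    by rewrite lerBrDl addrC lerNr opprD opprK lerBrDl addrC.
  rewrite expRD expa; have := expR_ge1Dx (t * k.+2%:R^-1).
  move/(ler_wpM2l (expR_ge0 (- (t * ln k.+2%:R)))); apply: le_trans.
  by rewrite mulrDr mulr1 addrC mulrCA.
suff H k : series (riemannR a) k.+1 <= 1 + t^-1 - t^-1 * (k.+1%:R `^ t)^-1.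
  case: n => [|n]; first by rewrite /series /= big_nil addr_ge0 // invr_ge0 ltW.
  apply: le_trans (H n) _; rewrite gerBl mulr_ge0 // invr_ge0 ?powR_ge0 //.
  exact: ltW.
elim: k => [|k IH].
  by rewrite seriesSr /series /= big_nil add0r /riemannR !powR1 invr1 mulr1 addrK.
rewrite seriesSr; apply: le_trans (lerD IH (step k)) _.
by rewrite mulrBr addrA subrK.
Qed.

Lemma seriesM (F : comNzRingType) (a b : nat -> F) (N : nat) :
  series a N * series b N = \sum_(d < N) \sum_(m < N) a d * b m.
Proof. by rewrite /series /= !big_mkord big_distrlr. Qed.

Lemma cvg_subr_null (K : numFieldType) (V : normedModType K) (f g : nat -> V) (l : V) :
  f @ \oo --> l -> g @ \oo --> (0 : V) -> (fun n => f n - g n) @ \oo --> l.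
Proof. by move=> fl g0; rewrite -[l]subr0; apply: cvgB. Qed.

(** The error is the sum over the complement of P N in [0, N[^2.  Its modulus
is at most the same sum for the majorants A and B, and once P N contains the
square [0, K[^2, that sum is at most the difference of the products of their
N-th and K-th partial sums. *)
Lemma cvg_exhausting_sum (R : realType) (a b : nat -> R[i]^o) (A B : nat -> R)
    (P : nat -> nat -> nat -> bool) :
  (forall k, `|a k| <= (A k)%:C) -> (forall k, `|b k| <= (B k)%:C) ->
  cvgn (series A) -> cvgn (series B) ->
  (forall K, \forall N \near \oo,
     forall d m, (d < K)%N -> (m < K)%N -> P N d m) ->
  (fun N => \sum_(d < N) \sum_(m < N | P N d m) a d * b m : R[i]^o) @ \oo -->
    (limn (series a) * limn (series b) : R[i]^o).
Proof.
move=> aA bB cA cB exh.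
have A0 k : 0 <= A k by rewrite -ler0c (le_trans _ (aA k)).
have B0 k : 0 <= B k by rewrite -ler0c (le_trans _ (bB k)).
have ca := cvg_series_complex _ _ _ aA cA.
have cb := cvg_series_complex _ _ _ bB cB.
pose rest (F : nmodType) (f : nat -> nat -> F) N :=
  \sum_(d < N) \sum_(m < N | ~~ P N d m) f d m.
have splitP (F : nmodType) (f : nat -> nat -> F) N :
    \sum_(d < N) \sum_(m < N) f d m =
    \sum_(d < N) \sum_(m < N | P N d m) f d m + rest F f N.
  rewrite -big_split; apply: eq_bigr => d _.
  by rewrite [LHS](bigID (fun m : 'I_N => P N d m)).
have rest0 : rest R (fun d m => A d * B m) N @[N --> \oo] --> 0.
  have /cvgrPdist_lt cAB :
      series A N * series B N @[N --> \oo] --> limn (series A) * limn (series B).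
    exact: cvgM.
  apply/cvgrPdist_lt => e e0; have e20 : 0 < e / 2 by rewrite divr_gt0.
  have [K _ HK] := cAB _ e20.
  near=> N.
  have KN : (K <= N)%N by near: N; exists K.
  have PN : forall d m, (d < K)%N -> (m < K)%N -> P N d m by near: N; apply: exh.
  have KX := HK _ (leqnn K); have NX := HK _ KN.
  rewrite /= in KX NX.
  have r0 : 0 <= rest R (fun d m => A d * B m) N.
    by apply: sumr_ge0 => d _; apply: sumr_ge0 => m _; rewrite mulr_ge0.
  rewrite sub0r normrN ger0_norm //.
  have : series A K * series B K + rest R (fun d m => A d * B m) N
         <= series A N * series B N.
    rewrite !seriesM (splitP R (fun d m => A d * B m) N) lerD2r.
    (* The square [0, K[^2 lies in P N, and all the terms are nonnegative. *)
    rewrite (big_ord_widen N (fun d => \sum_(m < K) A d * B m) KN) big_mkcond /=.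
    apply: ler_sum => d _; case: ifP => dK; last first.
      by apply: sumr_ge0 => m _; rewrite mulr_ge0.
    rewrite (big_ord_widen N (fun m => A d * B m) KN).
    rewrite [leLHS]big_mkcond [leRHS]big_mkcond; apply: ler_sum => m _.
    case: ifP => mK; first by rewrite PN.
    by case: ifP => _ //; rewrite mulr_ge0.
  move: KX NX; rewrite !ltr_norml => /andP[_ KX] /andP[NX _].
  lra.
have -> : (fun N => \sum_(d < N) \sum_(m < N | P N d m) a d * b m : R[i]^o) =
   (fun N => series a N * series b N - rest R[i] (fun d m => a d * b m) N).
  by apply/funext => N; rewrite seriesM (splitP R[i] (fun d m => a d * b m)) addrK.
have cM : series a N * series b N @[N --> \oo] -->
    (limn (series a) * limn (series b) : R[i]^o).
  exact: (@cvgM R[i] nat \oo _ (series a) (series b) _ _ ca cb).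
suff cr : rest R[i] (fun d m => a d * b m) N @[N --> \oo] --> (0 : R[i]^o).
  exact: (cvg_subr_null _ _ _ _ _ cM cr).
apply: cvg_complex_bound rest0 => N; rewrite sub0r normrN.
rewrite rmorph_sum; apply: le_trans (ler_norm_sum _ _ _) _; apply: ler_sum => d _.
rewrite rmorph_sum; apply: le_trans (ler_norm_sum _ _ _) _; apply: ler_sum => m _.
by rewrite normrM rmorphM /= ler_pM.
Unshelve. all: by end_near.
Qed.

(** * Complex powers of positive integers *)

Lemma cexpD (R : realType) (x y : R[i]) : cexp (x + y) = cexp x * cexp y.
Proof.
case: x y => [a b] [c d]; rewrite /cexp /= expRD cosD sinD; simpc.
by congr (_ +i* _); ring.
Qed.

Lemma cexp0 (R : realType) : cexp (0 : R[i]) = 1.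
Proof. by rewrite /cexp /= expR0 cos0 sin0; simpc. Qed.

Lemma ncpowM (R : realType) (m n : nat) (s : R[i]) : (0 < m)%N -> (0 < n)%N ->
  ncpow (m * n) s = ncpow m s * ncpow n s.
Proof.
move=> m0 n0; rewrite /ncpow -cexpD natrM lnM ?posrE ?ltr0n //.
by rewrite rmorphD mulrDr.
Qed.

Lemma ncpow1 (R : realType) (s : R[i]) : ncpow 1 s = 1.
Proof. by rewrite /ncpow ln1 mulr0 cexp0. Qed.

Lemma ncpowX (R : realType) (n k : nat) (s : R[i]) : (0 < n)%N ->
  ncpow (n ^ k) s = ncpow n s ^+ k.
Proof.
move=> n0; elim: k => [|k IH]; first by rewrite ncpow1.
by rewrite expnS ncpowM ?expn_gt0 ?n0 // IH exprS.
Qed.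

Lemma ncpowD (R : realType) (n : nat) (s t : R[i]) :
  ncpow n (s + t) = ncpow n s * ncpow n t.
Proof. by rewrite /ncpow mulrDl cexpD. Qed.

Lemma ncpowMn (R : realType) (n k : nat) (s : R[i]) :
  ncpow n (k%:R * s) = ncpow n s ^+ k.
Proof.
elim: k => [|k IH]; first by rewrite /ncpow !mul0r cexp0.
by rewrite -natr1 mulrDl mul1r ncpowD IH exprSr.
Qed.

Lemma ncpow_id (R : realType) (n : nat) : (0 < n)%N -> ncpow n (1 : R[i]) = n%:R.
Proof.
move=> n0; rewrite /ncpow /cexp mul1r /= cos0 sin0 lnK ?posrE ?ltr0n //.
by rewrite -[1 +i* 0]/(1 : R[i]) mulr1 rmorph_nat.
Qed.

Lemma norm_ncpow (R : realType) (n : nat) (s : R[i]) : (0 < n)%N ->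
  `|ncpow n s| = (n%:R `^ complex.Re s)%:C.
Proof.
move=> n0; rewrite /ncpow /cexp normrM norm_real_complex (ger0_norm (expR_ge0 _)).
rewrite normc_def /= cos2Dsin2 sqrtr1 mulr1.
rewrite /powR gt_eqF ?ltr0n //; congr (expR _)%:C.
by case: s => x y /=; rewrite mulr0 subr0.
Qed.

Lemma ncpow_neq0 (R : realType) (n : nat) (s : R[i]) : (0 < n)%N -> ncpow n s != 0.
Proof.
move=> n0; rewrite -normr_eq0 norm_ncpow // gt_eqF // ltcR.
by rewrite powR_gt0 ?ltr0n.
Qed.

Local Close Scope complex_scope.

(** * Dirichlet series *)

(** Since g is positive, every pair with g d m <= N falls in exactly one class
g d m = n + 1 with n < N. *)
Lemma sum_prod_le_by_value (F : nmodType) (g : nat -> nat -> nat)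
    (f : nat -> nat -> F) (N : nat) :
  (forall d m, (0 < g d m)%N) ->
  \sum_(d < N) \sum_(m < N | (g d m <= N)%N) f d m =
  \sum_(n < N) \sum_(d < N) \sum_(m < N | g d m == n.+1) f d m.
Proof.
move=> g0; rewrite [RHS]exchange_big; apply: eq_bigr => d _ /=.
rewrite (exchange_big_dep (fun m : 'I_N => (g d m <= N)%N)) /=; last first.
  by move=> n m _ /eqP ->.
apply: eq_bigr => m gN.
have gN' : ((g d m).-1 < N)%N by rewrite prednK.
rewrite (big_pred1 (Ordinal gN')) // => n.
by rewrite inE -(inj_eq (@ord_inj _)) /= -[RHS]eqSS prednK // eq_sym.
Qed.

Lemma ncpow_sub1 (R : realType) (n : nat) (s : R[i]) : (0 < n)%N ->
  ncpow n s = ncpow n (s - 1) * n%:R.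
Proof. by move=> n0; rewrite -[in RHS](ncpow_id R n n0) -ncpowD subrK. Qed.

(** The powers combine by d^-(l w + 1) m^-(w + 1) = (d^l m)^-w (d m)^-1, with
w = s - 1. *)
Lemma dirichlet_terms_mul (R : realType) (l : nat) (s : R[i]) (d m n : nat) :
  (d.+1 ^ l * m.+1)%N = n.+1 ->
  dirichlet_term (fun=> 1) (l%:R * (s - 1) + 1) d *
    dirichlet_term (totient_l R[i] l) s m =
  dirichlet_term (fun=> 1) (s - 1) n *
    (d.+1%:R^-1 * (totient_l R[i] l m.+1 / m.+1%:R)).
Proof.
move=> dmn; rewrite /dirichlet_term -dmn ncpowM ?expn_gt0 // ncpowX //.
rewrite (ncpowD _ _ (l%:R * _)) ncpowMn ncpow_id // (ncpow_sub1 _ _ s) //.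
have : ncpow d.+1 (s - 1) ^+ l != 0 by rewrite expf_neq0 ?ncpow_neq0.
have : ncpow m.+1 (s - 1) != 0 by apply: ncpow_neq0.
have : d.+1%:R != 0 :> R[i] by rewrite pnatr_eq0.
have : m.+1%:R != 0 :> R[i] by rewrite pnatr_eq0.
move: (_ ^+ l) (ncpow _ _) (d.+1%:R) (m.+1%:R) (totient_l _ _ _) => x y p q t *.
by field; do ![apply/andP; split].
Qed.

Lemma norm_dirichlet_unit (R : realType) (t : R[i]) (k : nat) :
  `|dirichlet_term (fun=> 1) t k| = (riemannR (complex.Re t) k)%:C%C.
Proof.
by rewrite /dirichlet_term mul1r normfV norm_ncpow // /riemannR -fmorphV.
Qed.

Lemma norm_dirichlet_totient_l (R : realType) (l : nat) (s : R[i]) (k : nat) :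
  `|dirichlet_term (totient_l R[i] l) s k| <=
  (riemannR (complex.Re (s - 1)) k)%:C%C.
Proof.
rewrite -norm_dirichlet_unit /dirichlet_term.
have := totient_l_bound R[i] l k.+1.
move: (totient_l _ _ _) => t /andP[t0 t1].
rewrite (ncpow_sub1 _ _ s) // !normrM !normfV normrM normr1 normr_nat invfM mulrCA.
rewrite mulrC; apply: ler_wpM2r; first by rewrite invr_ge0.
by rewrite ger0_norm // ler_pdivrMr ?mul1r // ltr0n.
Qed.

Lemma cvg_zeta (R : realType) (t : R[i]) : 1 < complex.Re t ->
  series (dirichlet_term (fun=> 1) t) @ \oo --> zeta t.
Proof.
move=> t1; apply: (@cvg_series_complex _ _ (riemannR (complex.Re t))).
  by move=> k; rewrite norm_dirichlet_unit.
exact: cvg_riemannR.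
Qed.

(** The terms after the first have modulus at most 1/n^2, and 1/4 plus the
telescoping bound 1/n^2 <= 1/(n - 1) - 1/n for n > 2 keeps every partial sum
of at least two terms within 3/4 of 1, hence away from 0. *)
Lemma zeta_neq0 (R : realType) (t : R[i]) : 2 <= complex.Re t -> zeta t != 0.
Proof.
move=> t2.
have t1 : 1 < complex.Re t by apply: lt_le_trans t2; rewrite ltr1n.
have bound k : riemannR (complex.Re t) k <= k.+1%:R^-1 ^+ 2.
  rewrite /riemannR exprVn lef_pV2 ?posrE ?powR_gt0 ?exprn_gt0 ?ltr0n //.
  by rewrite -powR_mulrn // ler_powR // ler1n.
have tail n : `|series (dirichlet_term (fun=> 1) t) n.+2 - 1|
              <= (3 / 4 - n.+2%:R^-1 : R)%:C%C.
  elim: n => [|n IH].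
    rewrite !seriesSr /series /= big_nil add0r {1}/dirichlet_term ncpow1 invr1.
    rewrite mulr1 addrAC subrr add0r norm_dirichlet_unit lecR.
    by apply: le_trans (bound 1%N) _; lra.
  rewrite seriesSr addrAC; apply: le_trans (ler_normD _ _) _.
  apply: le_trans (lerD IH (lexx _)) _.
  rewrite norm_dirichlet_unit -rmorphD lecR.
  apply: le_trans (lerD (lexx _) (bound n.+2)) _.
  have -> : n.+3%:R = n.+2%:R + 1 :> R by rewrite natr1.
  have : 0 < n.+2%:R :> R by rewrite ltr0n.
  move: (n.+2%:R) => x x0.
  have -> : x^-1 = (x + 1)^-1 + x^-1 * (x + 1)^-1.
    by field; rewrite !gt_eqF // addr_gt0.
  have : (x + 1)^-1 ^+ 2 <= x^-1 * (x + 1)^-1.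
    by rewrite expr2 ler_wpM2r ?invr_ge0 ?lef_pV2 ?posrE
      ?addr_ge0 ?addr_gt0 ?lerDl // ltW.
  lra.
apply/eqP => z0; have /cvgrPdist_lt := cvg_zeta _ _ t1; rewrite z0.
move=> /(_ (4^-1)); rewrite invr_gt0 ltr0n => /(_ isT)[N _ HN].
have := HN N.+2 (leq_trans (leqnSn _) (leqnSn _)); rewrite /= sub0r normrN => h.
have : (1 : R[i]) < 1; last by rewrite ltxx.
rewrite -{1}(normr1 R[i]) -[X in `|X|](subrK (series (dirichlet_term (fun=> 1) t) N.+2)).
apply: le_lt_trans (ler_normD _ _) _; rewrite distrC.
apply: lt_le_trans (ler_ltD (tail N) h) _.
have -> : (4^-1 : R[i]) = (4^-1 : R)%:C%C by rewrite fmorphV rmorph_nat.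
rewrite -rmorphD -(rmorph1 (real_complex R)) lecR.
have : 0 <= N.+2%:R^-1 :> R by rewrite invr_ge0.
move: (N.+2%:R^-1) => x; lra.
Qed.

Theorem theorem3p1 (R : realType) (l : nat) (s : R[i])
    (hl : (1 <= l)%N) (hs : 2 < complex.Re s) :
  series (dirichlet_term (totient_l R[i] l) s) @ \oo -->
    (zeta (s - 1) / zeta (l%:R * (s - 1) + 1) : R[i]^o).
Proof.
set u := l%:R * (s - 1) + 1.
have w1 : 1 < complex.Re (s - 1).
  by move: hs; case: (s) => x y /=; lra.
have u2 : 2 <= complex.Re u.
  have -> : complex.Re u = l%:R * complex.Re (s - 1) + 1.
    by rewrite /u !mulr_natl raddfD raddfMn.
  have : 1 <= l%:R :> R by rewrite ler1n.
  nra.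
have u1 : 1 < complex.Re u by apply: lt_le_trans u2; rewrite ltr1n.
set a := dirichlet_term (fun=> 1) u : nat -> R[i]^o.
set b := dirichlet_term (totient_l R[i] l) s : nat -> R[i]^o.
have cb : cvgn (series b).
  apply: cvg_series_complex (cvg_riemannR _ _ w1).
  exact: norm_dirichlet_totient_l.
have na k : `|a k| <= (riemannR (complex.Re u) k)%:C%C.
  by rewrite norm_dirichlet_unit.
have exhaust K : \forall N \near \oo, forall d m,
    (d < K)%N -> (m < K)%N -> (d.+1 ^ l * m.+1 <= N)%N.
  exists (K ^ l * K)%N => // N /= KN d m dK mK.
  by apply: leq_trans KN; rewrite leq_mul // leq_exp2r.
have := cvg_exhausting_sum _ a b _ _ (fun N d m => (d.+1 ^ l * m.+1 <= N)%N)
  na (norm_dirichlet_totient_l _ l s)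
  (cvg_riemannR _ _ u1) (cvg_riemannR _ _ w1) exhaust.
have -> : (fun N => \sum_(d < N) \sum_(m < N | (d.+1 ^ l * m.+1 <= N)%N) a d * b m)
          = series (dirichlet_term (fun=> 1) (s - 1)).
  apply/funext => N.
  have value_gt0 d m : (0 < d.+1 ^ l * m.+1)%N by rewrite muln_gt0 expn_gt0.
  apply: etrans (sum_prod_le_by_value _ _ (fun d m => a d * b m) N value_gt0) _.
  rewrite /series /= big_mkord; apply: eq_bigr => n _.
  rewrite -[RHS]mulr1 -[X in _ * X](sum_totient_l_ratio _ l n N hl (ltn_ord n)).
  rewrite mulr_sumr.
  apply: eq_bigr => d _; rewrite mulr_sumr; apply: eq_bigr => m /eqP dmn.
  exact: dirichlet_terms_mul.
move=> cprod.
have divE (x y z : R[i]) : x != 0 -> y * x = z -> y = z / x.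
  by move=> x0 <-; rewrite mulfK.
rewrite -(divE _ (limn (series b)) _ (zeta_neq0 _ _ u2)); first exact: cb.
by rewrite mulrC; have := norm_cvg_lim cprod => <-.
Qed.
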